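(* Let $WB_n$ be the welded braid group on $n$ strands and let $WB_n'=[WB_n,WB_n]$ be its commutator subgroup. (i) For all $n\ge 3$, $WB_n'$ is finitely generated. For $n\ge 7$, the rank of $WB_n'$ is at most $1+2(n-3)$, and for $3\le n\le 6$, the rank of $WB_n'$ is at most $4+2(n-3)$. (ii) For $n\ge 5$, $WB_n'$ is perfect.
   Context: The welded braid group $WB_n$ is the group with generators $\sigma_i,\rho_i$ ($1\le i\le n-1$) and the following defining relations (for all indices for which they make sense): braid relations $\sigma_i\sigma_j=\sigma_j\sigma_i$ if $|i-j|>1$, $\sigma_i\sigma_{i+1}\sigma_i=\sigma_{i+1}\sigma_i\sigma_{i+1}$; symmetric relations $\rho_i^2=1$, $\rho_i\rho_j=\rho_j\rho_i$ if $|i-j|>1$, $\rho_i\rho_{i+1}\rho_i=\rho_{i+1}\rho_i\rho_{i+1}$; mixed relations $\sigma_i\rho_j=\rho_j\sigma_i$ if $|i-j|>1$, $\rho_i\rho_{i+1}\sigma_i=\sigma_{i+1}\rho_i\rho_{i+1}$; forbidden relations $\rho_i\sigma_{i+1}\sigma_i=\sigma_{i+1}\sigma_i\rho_{i+1}$. The rank of a finitely generated group is the minimal number of elements in a generating set. A group is perfect if it equals its commutator subgroup. *)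

(* Defs.v *)
From HB Require Import structures.
From mathcomp Require Import all_boot finmap.
From mathcomp Require Import boolp classical_sets.

Set Implicit Arguments.
Unset Strict Implicit.
Unset Printing Implicit Defensive.

Local Open Scope group_scope.
Local Open Scope classical_set_scope.
Local Open Scope quotient_scope.

(** * Groups given by generators and relations *)

(* A word is a product of letters, the letter (false, x) standing for the
   generator x and (true, x) for its inverse. *)
Definition word (T : Type) := seq (bool * T).

Definition gen_word (T : Type) (x : T) : word T := [:: (false, x)].

Definition inv_word (T : Type) (u : word T) : word T :=
  rev [seq (~~ a.1, a.2) | a <- u].

Section PresentedGroup.

Variables (T : choiceType) (R : word T -> word T -> Prop).

(* The least congruence that contains the relations R and makes the two letters
   of a generator inverse to each other. *)
Inductive word_cong : word T -> word T -> Prop :=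
| cong_rel u v : R u v -> word_cong u v
| cong_cancel b x : word_cong [:: (b, x); (~~ b, x)] [::]
| cong_cat u u' v v' :
    word_cong u u' -> word_cong v v' -> word_cong (u ++ v) (u' ++ v')
| cong_refl u : word_cong u u
| cong_sym u v : word_cong u v -> word_cong v u
| cong_trans u v w : word_cong u v -> word_cong v w -> word_cong u w.

Definition word_congb : rel (word T) := fun u v => `[< word_cong u v >].

Lemma word_congb_equiv : equiv_class_of word_congb.
Proof.
split=> [u|u v|v u w].
- exact/asboolP/cong_refl.
- by apply/asboolP/asboolP; apply: cong_sym.
- by move=> /asboolP uv /asboolP vw; apply/asboolP/(cong_trans uv vw).
Qed.

Canonical word_congb_equivRel := EquivRelPack word_congb_equiv.

Definition presented := {eq_quot word_congb}.

HB.instance Definition _ : EqQuotient _ word_congb presented :=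
  EqQuotient.on presented.
HB.instance Definition _ := Choice.on presented.

Definition word_class (u : word T) : presented := \pi_presented u.

Lemma word_classE u v : word_class u = word_class v <-> word_cong u v.
Proof. by split=> [/eqmodP/asboolP|uv] //; apply/eqmodP/asboolP. Qed.

Lemma cong_repr u : word_cong (repr (word_class u)) u.
Proof. by apply/word_classE; rewrite /word_class reprK. Qed.

Lemma cong_mulV u : word_cong (u ++ inv_word u) [::].
Proof.
rewrite /inv_word; elim: u => [|[b x] u IHu]; first exact: cong_refl.
rewrite /= rev_cons -cats1 catA -cat1s.
apply: (cong_trans (v := [:: (b, x)] ++ [::] ++ [:: (~~ b, x)])).
  apply: (@cong_cat [:: _] [:: _]); first exact: cong_refl.
  by apply: cong_cat; last exact: cong_refl.
exact: cong_cancel.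
Qed.

Lemma inv_wordK : involutive (@inv_word T).
Proof.
move=> u; rewrite /inv_word map_rev revK -map_comp -[RHS]map_id.
by apply: eq_map => -[b x] /=; rewrite negbK.
Qed.

Lemma cong_inv u v : word_cong u v -> word_cong (inv_word u) (inv_word v).
Proof.
move=> uv.
have Vu : word_cong (inv_word u ++ u) [::].
  by rewrite -{2}(inv_wordK u); exact: cong_mulV.
apply: (cong_trans (v := inv_word u ++ (v ++ inv_word v))).
  rewrite -[X in word_cong X]cats0.
  by apply: cong_cat; [exact: cong_refl | exact/cong_sym/cong_mulV].
rewrite catA -[X in word_cong _ X]cat0s; apply: cong_cat; last exact: cong_refl.
apply: cong_trans Vu; apply: cong_cat; first exact: cong_refl.
exact: cong_sym.
Qed.

Definition presented_mul (a b : presented) : presented :=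
  word_class (repr a ++ repr b).

Definition presented_one : presented := word_class [::].

Definition presented_inv (a : presented) : presented :=
  word_class (inv_word (repr a)).

Lemma presented_mulE u v :
  presented_mul (word_class u) (word_class v) = word_class (u ++ v).
Proof. by apply/word_classE/cong_cat; exact: cong_repr. Qed.

Lemma presented_invE u :
  presented_inv (word_class u) = word_class (inv_word u).
Proof. by apply/word_classE/cong_inv/cong_repr. Qed.

Lemma presentedP (a : presented) : exists u, a = word_class u.
Proof. by exists (repr a); rewrite /word_class reprK. Qed.

Lemma presented_mulA : associative presented_mul.
Proof.
move=> a b c; have [u ->] := presentedP a; have [v ->] := presentedP b.
by have [w ->] := presentedP c; rewrite !presented_mulE catA.
Qed.

Lemma presented_1mul : left_id presented_one presented_mul.
Proof. by move=> a; have [u ->] := presentedP a; rewrite presented_mulE. Qed.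

Lemma presented_mul1 : right_id presented_one presented_mul.
Proof.
by move=> a; have [u ->] := presentedP a; rewrite presented_mulE cats0.
Qed.

Lemma presented_mulV : right_inverse presented_one presented_inv presented_mul.
Proof.
move=> a; have [u ->] := presentedP a; rewrite presented_invE presented_mulE.
exact/word_classE/cong_mulV.
Qed.

Lemma presented_Vmul : left_inverse presented_one presented_inv presented_mul.
Proof.
move=> a; have [u ->] := presentedP a; rewrite presented_invE presented_mulE.
by apply/word_classE; rewrite -{2}(inv_wordK u); exact: cong_mulV.
Qed.

HB.instance Definition _ := isGroup.Build presented
  presented_mulA presented_1mul presented_mul1 presented_Vmul presented_mulV.

End PresentedGroup.

(** * Subgroups of a possibly infinite group, as classical sets *)

Section Subgroups.

Variable G : groupType.
Implicit Types A H : set G.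

Definition subgroup H : Prop := group_closed [in H].

Definition generated A : set G := smallest subgroup A.

Definition derived H : set G :=
  generated [set [~ x, y] | x in H & y in H].

Definition perfect H : Prop := derived H = H.

Definition finitely_generated H : Prop :=
  exists A : {fset G}, generated [set` A] = H.

Definition generated_by_card H (k : nat) : Prop :=
  exists2 A : {fset G}, generated [set` A] = H & #|` A| = k.

(* The rank is meant for finitely generated H; other H get the value 0. *)
Definition group_rank H : nat :=
  if pselect (exists k, `[< generated_by_card H k >]) is left exk
  then ex_minn exk else 0%N.

End Subgroups.

(** * Welded braid groups *)

(* With indices counted from 0, inl i stands for sigma_(i+1) and inr i for
   rho_(i+1), where i < n - 1. *)
Definition wb_gen (n : nat) : choiceType := ('I_n.-1 + 'I_n.-1)%type.

Section WeldedBraidGroup.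

Variable n : nat.

Local Notation s i := (gen_word (inl i : wb_gen n)).
Local Notation r i := (gen_word (inr i : wb_gen n)).

(* |i - j| > 1 *)
Definition far (i j : 'I_n.-1) : bool := (i.+1 < j) || (j.+1 < i).

(* In the constructors with a hypothesis j = i.+1, j plays the role of i + 1. *)
Inductive wb_rel : word (wb_gen n) -> word (wb_gen n) -> Prop :=
| wb_braid_far (i j : 'I_n.-1) of far i j :
    wb_rel (s i ++ s j) (s j ++ s i)
| wb_braid (i j : 'I_n.-1) of j = i.+1 :> nat :
    wb_rel (s i ++ s j ++ s i) (s j ++ s i ++ s j)
| wb_sym_sqr (i : 'I_n.-1) : wb_rel (r i ++ r i) [::]
| wb_sym_far (i j : 'I_n.-1) of far i j :
    wb_rel (r i ++ r j) (r j ++ r i)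
| wb_sym (i j : 'I_n.-1) of j = i.+1 :> nat :
    wb_rel (r i ++ r j ++ r i) (r j ++ r i ++ r j)
| wb_mixed_far (i j : 'I_n.-1) of far i j :
    wb_rel (s i ++ r j) (r j ++ s i)
| wb_mixed (i j : 'I_n.-1) of j = i.+1 :> nat :
    wb_rel (r i ++ r j ++ s i) (s j ++ r i ++ r j)
| wb_forbidden (i j : 'I_n.-1) of j = i.+1 :> nat :
    wb_rel (r i ++ s j ++ s i) (s j ++ s i ++ r j).

Definition WB : groupType := presented wb_rel.

Definition WB' : set WB := derived [set: WB].

End WeldedBraidGroup.

Arguments WB' n _ : clear implicits.

(* Main.v *)
Require Import Defs.
From mathcomp Require Import all_boot finmap.
From mathcomp Require Import boolp classical_sets.

(** Write $a = \rho_1\sigma_1$, $r = \rho_1$, $q = \rho_2$, $c = rq$ and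
    $b = qaq$.  The mixed relations express every $\sigma_i$ through $\sigma_1$
    and the $\rho$'s, so $WB_n$ is generated by $a$ and the involutions $\rho_i$,
    and beside the relations among the $\rho$'s only three consequences of the
    defining relations matter: $a$ commutes with
    $\rho_i$ for $i \ge 3$; the forbidden relation says that $a$ commutes with
    $b$ ([forbidden_commute]); the braid relation says that $ab$ commutes with
    $c a c^{-1}$ ([braid_commute]).  The last two are McCool's relations among the
    generators $x_i \mapsto x_j^{-1} x_i x_j$ of the pure welded braid group.

    For the generators, put $x = a b^{-1}$, which commutes with $a$, write
    $g^h = h^{-1} g h$, and let $H$ be generated by the $n + 1$ elements
    $x, c, c^a, c^{a^2}, \rho_3 q, \dots, \rho_{n-1} q$.
    All of them lie in $WB_n'$.  Conversely, if $H$ is normal then modulo $H$ every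
    $\rho_i$ equals $q$, and $q$ commutes with $a$ because $x \in H$; so $WB_n / H$
    is abelian and $WB_n' \subseteq H$ ([derived_sub_two]).  For normality the one
    real point is that conjugation by $a$ preserves $H$, that is, that all
    $c_k = c^{a^k}$ are in $H$.
    Since $ab = x^{-1} a^2$ commutes with $a$ and with $c a c^{-1}$, it commutes
    with $v = a^{-1} c a c^{-1} = c_1 c_0^{-1}$, hence $v^{a^2} = v^x$.
    This reads $c_3 c_2^{-1} = (c_1 c_0^{-1})^x$, and its conjugate by $a^{-1}$
    expresses $c_{-1}$ through $c_0, c_1, c_2, x$ ([conj_orbit_steps]).
    Altogether this is [generated_derived_gens].
    Finally $n + 1 \le 4 + 2(n - 3)$ for $n \ge 3$ and
    $n + 1 \le 1 + 2(n - 3)$ for $n \ge 7$.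

    For perfectness, let $n \ge 5$ and $N = WB_n''$.  As $\rho_4$ commutes with
    $\rho_1$ and $\rho_2$, the element
    $[\rho_1\rho_4, \rho_2\rho_4] = [\rho_1, \rho_2] = \rho_2\rho_1$ is in $N$,
    and so are its conjugates $\rho_{i+1}\rho_i$.  Modulo $N$ all $\rho_i$ thus
    equal $\rho_4$, which commutes with $a$; so $WB_n / N$ is abelian and
    $WB_n' \subseteq N$. *)

Set Implicit Arguments.
Unset Strict Implicit.
Unset Printing Implicit Defensive.

Local Open Scope group_scope.
Local Open Scope classical_set_scope.

(** * Subgroups, normality and commutators *)

Section SubgroupTheory.

Variable G : groupType.
Implicit Types (A H N : set G) (g x y : G).

Lemma commute_conjg x y : commute x y -> x ^ y = x.
Proof. by move=> xy; apply/conjg_fixP/commgP. Qed.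

Lemma subgroupP H :
  subgroup H <-> [/\ H 1, forall x y, H x -> H y -> H (x * y)
                   & forall x, H x -> H x^-1].
Proof.
split=> [cH | [H1 HM HV]].
  split; first by have [/set_mem] := cH.
    by move=> x y Hx Hy; apply/set_mem/(group_closedM cH); exact/mem_set.
  by move=> x Hx; apply/set_mem/(group_closedV cH); exact/mem_set.
split=> [|x y]; first exact/mem_set.
by move=> /set_mem Hx /set_mem Hy; apply/mem_set/HM/HV.
Qed.

Lemma subgroup1 H : subgroup H -> H 1.
Proof. by case/subgroupP. Qed.

Lemma subgroupM H x y : subgroup H -> H x -> H y -> H (x * y).
Proof. by case/subgroupP=> _ HM _; exact: HM. Qed.

Lemma subgroupV H x : subgroup H -> H x -> H x^-1.
Proof. by case/subgroupP=> _ _ HV; exact: HV. Qed.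

Lemma subgroupJ H x y : subgroup H -> H x -> H y -> H (x ^ y).
Proof.
by move=> sH Hx Hy; do 2?apply: subgroupM => //; exact: subgroupV.
Qed.

Lemma generated_subgroup A : subgroup (generated A).
Proof.
apply/subgroupP; split=> [|x y Ax Ay|x Ax] K [sK AK].
- exact: subgroup1.
- by apply: subgroupM => //; [apply: Ax | apply: Ay].
- by apply: subgroupV => //; apply: Ax.
Qed.

Lemma sub_generated A : A `<=` generated A.
Proof. exact: sub_gen_smallest. Qed.

Lemma generated_sub A H : subgroup H -> A `<=` H -> generated A `<=` H.
Proof. exact: smallest_sub. Qed.

Lemma derived_subgroup H : subgroup (derived H).
Proof. exact: generated_subgroup. Qed.

Lemma derivedR H x y : H x -> H y -> derived H [~ x, y].
Proof. by move=> Hx Hy; apply: sub_generated; exists x => //; exists y. Qed.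

Definition normal H := forall x g, H x -> H (x ^ g).

Lemma subgroup_conj_preimage H g : subgroup H -> subgroup [set x | H (x ^ g)].
Proof.
move=> sH; apply/subgroupP; split=> [|x y Hx Hy|x Hx] /=.
- by rewrite conj1g; exact: subgroup1.
- by rewrite conjMg; exact: subgroupM.
- by rewrite conjVg; exact: subgroupV.
Qed.

Lemma derived_normal H : normal H -> normal (derived H).
Proof.
move=> nH x g; have sD := subgroup_conj_preimage g (derived_subgroup H).
move: x; apply: (generated_sub sD) => _ [y Hy [z Hz <-]] /=.
by rewrite conjRg; apply: derivedR; exact: nH.
Qed.

(** Both directions are required because a subgroup of an infinite group can be
    mapped by a conjugation onto a proper subgroup of itself. *)
Definition normalizer H : set G :=
  [set g | forall x, H x -> H (x ^ g) /\ H (x ^ g^-1)].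

Lemma normalizer_subgroup H : subgroup (normalizer H).
Proof.
apply/subgroupP; split=> [x|g h Ng Nh x Hx|g Ng x /Ng[]].
- by rewrite invg1 conjg1.
- rewrite invgM !conjgM; split.
    exact: (Nh _ (Ng _ Hx).1).1.
  exact: (Ng _ (Nh _ Hx).2).2.
- by rewrite invgK.
Qed.

Lemma sub_normalizer H : subgroup H -> H `<=` normalizer H.
Proof.
by move=> sH g Hg x Hx; split; apply: subgroupJ => //; exact: subgroupV.
Qed.

Lemma mem_normalizer_generated A g :
    (forall x, A x -> generated A (x ^ g)) ->
    (forall x, A x -> generated A (x ^ g^-1)) ->
  normalizer (generated A) g.
Proof.
move=> Ag AgV x gx; have sA := generated_subgroup A.
split; first exact: (generated_sub (subgroup_conj_preimage g sA) Ag).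
exact: (generated_sub (subgroup_conj_preimage g^-1 sA) AgV).
Qed.

(** This is the preimage of the centralizer of $y$ in $G / N$.  Working with it
    avoids building quotients of infinite groups. *)
Lemma commg_mod_subgroup N y :
  subgroup N -> normal N -> subgroup [set x | N [~ x, y]].
Proof.
move=> sN nN; apply/subgroupP; split=> [|x z Nx Nz|x Nx] /=.
- by rewrite commgEl conj1g mulg1 invg1; exact: subgroup1.
- suff -> : [~ x * z, y] = [~ x, y] ^ z * [~ z, y].
    by apply: subgroupM => //; exact: nN.
  by rewrite !commgEl conjMg invgM !conjgE !mulgA !mulgK.
- suff -> : [~ x^-1, y] = [~ y, x] ^ x^-1.
    by apply: nN; rewrite -invgR; exact: subgroupV.
  by rewrite !commgEl !conjgE invgK !mulgA mulgK.
Qed.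

(** The quotient $G / N$ is abelian as soon as its generators commute. *)
Lemma derived_sub_generated A N : subgroup N -> normal N ->
    generated A = [set: G] ->
    (forall x y, A x -> A y -> N [~ x, y]) ->
  derived [set: G] `<=` N.
Proof.
move=> sN nN genA AN; apply: generated_sub => // _ [x _ [y _ <-]].
have genE B z : subgroup B -> A `<=` B -> B z.
  by move=> sB AB; apply: (generated_sub sB AB); rewrite genA.
suff Ay z : A z -> N [~ z, y].
  exact: (genE [set x | N [~ x, y]] x (commg_mod_subgroup y sN nN)).
move=> Az; rewrite -invgR; apply: subgroupV => //.
apply: (genE [set y | N [~ y, z]] y (commg_mod_subgroup z sN nN)).
by move=> t At /=; exact: AN.
Qed.

(** The form of the abelian quotient argument used both for the generators of
    $WB_n'$ and for its perfectness: modulo $N$ two commuting elements generate. *)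
Lemma derived_sub_two N g h : subgroup N -> normal N ->
    generated (N `|` [set g; h]) = [set: G] -> N [~ g, h] ->
  derived [set: G] `<=` N.
Proof.
move=> sN nN genN Ngh; apply: (derived_sub_generated sN nN genN).
have Nl x y : N x -> N [~ x, y].
  move=> Nx; rewrite commgEl.
  by apply: subgroupM => //; [exact: subgroupV | exact: nN].
have NC x y : N [~ x, y] -> N [~ y, x].
  by move=> Nxy; rewrite -invgR; exact: subgroupV.
move=> x y [/Nl //|xgh] [/Nl/NC //|ygh].
by case: xgh => ->; case: ygh => ->; rewrite ?commgg //;
  do ?[exact: subgroup1 | exact: NC].
Qed.

End SubgroupTheory.

(** * Commutation relations in three strands *)

Section WeldedTriple.

Variables (G : groupType) (r q s t a b : G).
Hypotheses (rr : r * r = 1) (qq : q * q = 1) (rqr : r * q * r = q * r * q).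
Hypotheses (sts : s * t * s = t * s * t) (rqs : r * q * s = t * r * q).
Hypotheses (rts : r * t * s = t * s * q) (aE : a = r * s) (bE : b = a ^ q).

Let rK u : u * r * r = u. Proof. by rewrite -mulgA rr mulg1. Qed.
Let qK u : u * q * q = u. Proof. by rewrite -mulgA qq mulg1. Qed.
Let rV : r^-1 = r. Proof. exact: mulg1_eq. Qed.
Let qV : q^-1 = q. Proof. exact: mulg1_eq. Qed.
Let sE : s = r * a. Proof. by rewrite aE mulgA rr mul1g. Qed.

(* The mixed relation eliminates t; both other relations become relations
   between a, b and the transpositions. *)
Let tE : t = q * r * b * r.
Proof.
have -> : t = r * q * s * q * r by rewrite rqs qK rK.
by rewrite sE bE conjgE qV !mulgA rqr.
Qed.

(** Once $t$ is eliminated, the forbidden relation reads $q (ba) = (ba) q$.  As $q$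
    swaps $a$ and $b$, this is $ba = ab$. *)
Lemma forbidden_commute : commute a b.
Proof.
have e : r * t * s = q * r * (q * (b * a)).
  by rewrite tE sE !mulgA rqr rK.
have e' : t * s * q = q * r * (b * a * q).
  by rewrite tE sE !mulgA rK.
have /mulgI com_q : q * r * (q * (b * a)) = q * r * (b * a * q).
  by rewrite -e rts.
have : (b * a) ^ q = b * a by rewrite conjgE -com_q mulgA qV qq mul1g.
by rewrite conjMg {1}bE -conjgM qq conjg1 -bE.
Qed.

(** The conjugate of $a$ in question is $rbr$.  Once $t$ is eliminated, the braid
    relation says that $ab$ commutes with $q \cdot rbr$; since $q$ commutes with
    $ab$ by [forbidden_commute], so does $rbr$. *)
Lemma braid_commute : commute (a * b) (a ^ (r * q)^-1).
Proof.
have com_q : q * (a * b) = a * b * q.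
  by rewrite {1}forbidden_commute bE conjgE qV !mulgA qq mul1g qK.
have qb u : u * q * b = u * a * q by rewrite bE conjgE qV !mulgA qK.
have uE : a ^ (r * q)^-1 = r * b * r.
  by rewrite invgM rV qV conjgM -bE conjgE rV mulgA.
rewrite uE.
have e : s * t * s = q * r * (q * (r * b * r) * (a * b)).
  by rewrite forbidden_commute tE sE !mulgA -rqr !rK qb.
have e' : t * s * t = q * r * ((a * b) * (q * (r * b * r))).
  by rewrite forbidden_commute tE sE !mulgA rK.
have /mulgI : q * r * (q * (r * b * r) * (a * b)) =
    q * r * ((a * b) * (q * (r * b * r))) by rewrite -e sts.
by rewrite [RHS]mulgA -com_q -!(mulgA q) => /mulgI.
Qed.

End WeldedTriple.

(** * Generators of the derived subgroup *)

(** With $c_k = c^{a^k}$, the relation $v^{a^2} = v^x$ for $v = c_1 c_0^{-1}$ is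
    $c_3 c_2^{-1} = (c_1 c_0^{-1})^x$; conjugated by $a^{-1}$, it is
    $c_2 c_1^{-1} = (c_0 c_{-1}^{-1})^x$.  Solving for $c_3$ and $c_{-1}$ shows that
    three consecutive conjugates of $c$, together with $x$, suffice. *)
Lemma conj_orbit_steps (G : groupType) (H : set G) (a c x : G) :
    subgroup H -> commute x a ->
    (c ^ a / c) ^ (a * a) = (c ^ a / c) ^ x ->
    H x -> H c -> H (c ^ a) -> H (c ^ (a * a)) ->
  H (c ^ (a * a * a)) /\ H (c ^ a^-1).
Proof.
move=> sH xa vE Hx Hc Hc1 Hc2.
have Hv : H (c ^ a / c) by apply: subgroupM => //; exact: subgroupV.
have Hv1 : H ((c ^ a / c) ^ a).
  rewrite conjMg conjVg -conjgM.
  by apply: subgroupM => //; exact: subgroupV.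
split.
  have -> : c ^ (a * a * a) = (c ^ a / c) ^ (a * a) * c ^ (a * a).
    by rewrite -conjMg mulgVK -conjgM mulgA.
  by rewrite vE; apply: subgroupM => //; exact: subgroupJ.
have e : (c ^ a / c) ^ a^-1 = ((c ^ a / c) ^ a) ^ x^-1.
  have -> : (c ^ a / c) ^ a = ((c ^ a / c) ^ x) ^ a^-1.
    by rewrite -vE -[in RHS]conjgM mulgK.
  rewrite -!conjgM; congr (_ ^ _).
  by rewrite mulgA (commuteV xa) mulgK.
have -> : c ^ a^-1 = ((c ^ a / c) ^ a^-1)^-1 * c.
  by rewrite conjMg conjgK conjVg invgM invgK mulgVK.
apply: subgroupM => //; apply: subgroupV => //.
by rewrite e; apply: subgroupJ => //; exact: subgroupV.
Qed.

Section DerivedGenerators.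

Variables (G : groupType) (r q a : G) (ps : seq G).
Hypotheses (rr : r * r = 1) (qq : q * q = 1).
Hypothesis com_b : commute a (a ^ q).
Hypothesis com_c : commute (a * a ^ q) (a ^ (r * q)^-1).
Hypothesis pp : forall p, p \in ps -> p * p = 1.
Hypothesis com_p : forall p, p \in ps -> commute a p.

Let c := r * q.
Let x := [~ a^-1, q].

(** The list [ps] stands for $\rho_3, \dots, \rho_{n-1}$; it is empty if $n = 3$. *)
Definition derived_gens : seq G :=
  [:: x; c; c ^ a; c ^ (a * a)] ++ [seq p * q | p <- ps].

Let H := generated [set` derived_gens].

Let sH : subgroup H. Proof. exact: generated_subgroup. Qed.

Let Hg y : y \in derived_gens -> H y. Proof. exact: sub_generated. Qed.

Let Hx : H x. Proof. by apply: Hg; rewrite !inE eqxx. Qed.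
Let Hc : H c. Proof. by apply: Hg; rewrite !inE eqxx ?orbT. Qed.
Let Hc1 : H (c ^ a). Proof. by apply: Hg; rewrite !inE eqxx ?orbT. Qed.
Let Hc2 : H (c ^ (a * a)). Proof. by apply: Hg; rewrite !inE eqxx ?orbT. Qed.

Let Hp p : p \in ps -> H (p * q).
Proof.
move=> p_ps; apply: Hg.
by rewrite mem_cat (map_f (fun z => z * q) p_ps) orbT.
Qed.

Let derived_gensP y : y \in derived_gens ->
  [\/ [\/ y = x | y = c], y = c ^ a, y = c ^ (a * a)
    | exists2 p, p \in ps & y = p * q].
Proof.
rewrite mem_cat !inE -!orbA => /or4P[/eqP|/eqP|/eqP|/orP[/eqP|/mapP]] Hy.
- by apply: Or41; left.
- by apply: Or41; right.
- exact: Or42.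
- exact: Or43.
- by apply: Or44; case: Hy => p; exists p.
Qed.

Let qV : q^-1 = q. Proof. exact: mulg1_eq. Qed.
Let rV : r^-1 = r. Proof. exact: mulg1_eq. Qed.

Let xE : x = a * (a ^ q)^-1.
Proof. by rewrite /x commgEl invgK conjVg. Qed.

Let com_x : commute x a.
Proof.
by rewrite xE /commute -mulgA; congr (_ * _); exact/commute_sym/commuteV.
Qed.

Let aqE : a ^ q = x^-1 * a.
Proof. by rewrite xE invgM invgK mulgVK. Qed.

(* The product a * a ^ q = x^-1 * (a * a) centralizes a and a ^ c^-1, hence
   c ^ a / c, which is a^-1 * a ^ c^-1. *)
Let step_hyp : (c ^ a / c) ^ (a * a) = (c ^ a / c) ^ x.
Proof.
have -> : c ^ a / c = a^-1 * a ^ c^-1.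
  by rewrite !conjgE invgK !mulgA.
have -> : a * a = a * a ^ q * x.
  by rewrite aqE -!mulgA -com_x mulKg.
rewrite conjgM; congr (_ ^ x).
have com_a : commute a (a * a ^ q).
  by apply: commuteM => //; exact: commute_refl.
rewrite conjMg conjVg (commute_conjg com_a).
by rewrite (commute_conjg (commute_sym com_c)).
Qed.

Let xq : x ^ q = x^-1.
Proof. by rewrite xE conjMg conjVg -conjgM qq conjg1 invgM invgK. Qed.

Let norm_a : normalizer H a.
Proof.
have [Hc3 HcV] := conj_orbit_steps sH com_x step_hyp Hx Hc Hc1 Hc2.
have xa : x ^ a = x by exact: commute_conjg.
have qa : q ^ a = q * x.
  apply: (mulgI a); rewrite -conjgC [RHS]mulgA (conjgC a q) aqE.
  by rewrite -!mulgA -com_x mulKg.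
have qaV : q ^ a^-1 = q * x^-1.
  by apply: (conjg_inj a); rewrite conjgKV conjMg conjVg xa qa mulgK.
have pa p : p \in ps -> p ^ a = p /\ p ^ a^-1 = p.
  move=> /com_p/commute_sym com_pa.
  by split; apply: commute_conjg => //; exact: commuteV.
apply: mem_normalizer_generated => y /derived_gensP[[]|||[p p_ps]] ->.
- by rewrite xa.
- exact: Hc1.
- by rewrite -conjgM.
- by rewrite -conjgM.
- by rewrite conjMg (pa _ p_ps).1 qa mulgA; exact: (subgroupM sH (Hp p_ps)).
- by rewrite -{1}xa conjgK.
- exact: HcV.
- by rewrite conjgK.
- by rewrite conjgM conjgK.
- rewrite conjMg (pa _ p_ps).2 qaV mulgA.
  exact: (subgroupM sH (Hp p_ps) (subgroupV sH Hx)).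
Qed.

(* Conjugation by q inverts x, c and each p * q, and it maps a to a * x^-1.  So it
   sends c ^ (a ^+ k) to the inverse of c ^ (a ^+ k) conjugated by x ^- k. *)
Let norm_q : normalizer H q.
Proof.
have cq : c ^ q = c^-1.
  by rewrite conjgE /c invgM rV qV -!mulgA qq mulg1.
have aq : a ^ q = a * x^-1.
  by rewrite aqE; apply/commute_sym/commuteV/commute_sym.
have HxV : H x^-1 by exact: (subgroupV sH Hx).
have Hq y : y \in derived_gens -> H (y ^ q).
  move=> /derived_gensP[[]|||[p p_ps]] ->.
  - by rewrite xq.
  - by rewrite cq; exact: (subgroupV sH Hc).
  - rewrite conjJg cq aq conjgM !conjVg.
    exact: (subgroupV sH (subgroupJ sH Hc1 HxV)).
  - rewrite conjJg cq conjMg aq.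
    have -> : a * x^-1 * (a * x^-1) = a * a * (x^-1 * x^-1).
      rewrite -!mulgA; congr (_ * _); rewrite !mulgA; congr (_ * _).
      exact/commute_sym/commuteV/commute_sym.
    rewrite conjgM !conjVg.
    exact: (subgroupV sH (subgroupJ sH Hc2 (subgroupM sH HxV HxV))).
  - have -> : (p * q) ^ q = (p * q)^-1.
      by rewrite conjgE invgM qV (mulg1_eq (pp p_ps)) -!mulgA qq mulg1.
    exact: (subgroupV sH (Hp p_ps)).
by apply: mem_normalizer_generated; rewrite ?qV.
Qed.

Hypothesis genG : generated ([set` ps] `|` [set r; q; a]) = [set: G].

Let full K : subgroup K -> [set` ps] `|` [set r; q; a] `<=` K -> K = [set: G].
Proof. by move=> sK AK; rewrite -subTset -genG; exact: generated_sub. Qed.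

(* The elements r and p are products of q with elements of H. *)
Let normal_H : normal H.
Proof.
have HN := sub_normalizer sH; have sN := normalizer_subgroup H.
have NT : normalizer H = [set: G].
  apply: full => // z [/= z_ps|[[]|] ->] //.
    by rewrite -[z]mulg1 -qq mulgA; exact: (subgroupM sN (HN _ (Hp z_ps))).
  by rewrite -[r]mulg1 -qq mulgA; exact: (subgroupM sN (HN _ Hc)).
move=> y g Hy; have : normalizer H g by rewrite NT.
by move=> /(_ y Hy)[].
Qed.

(** Normality of the generated subgroup reduces the inclusion of the derived
    subgroup to $[a, q] = x^{-1}$. *)
Lemma generated_derived_gens :
    derived [set: G] (r * q) ->
    (forall p, p \in ps -> derived [set: G] (p * q)) ->
  generated [set` derived_gens] = derived [set: G].
Proof.
move=> Dc Dp; have sD := derived_subgroup [set: G].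
have nD : normal (derived [set: G]) by exact: derived_normal.
apply/seteqP; split.
  apply: generated_sub => // y /derived_gensP[[]|||[p p_ps]] -> //.
  - exact: derivedR.
  - exact: nD.
  - exact: nD.
  - exact: Dp.
apply: (@derived_sub_two _ H a q) => //.
  have sK := generated_subgroup (H `|` [set a; q]).
  have K y : (H `|` [set a; q]) y -> generated (H `|` [set a; q]) y.
    exact: sub_generated.
  have Kq : generated (H `|` [set a; q]) q by apply: K; right; right.
  apply: full => // z [/= z_ps|[[]|] ->] //.
  - rewrite -[z]mulg1 -qq mulgA; apply: (subgroupM sK) Kq.
    by apply: K; left; exact: Hp.
  - by rewrite -[r]mulg1 -qq mulgA; apply: (subgroupM sK) Kq; apply: K; left.
  - by apply: K; right; left.
have -> : [~ a, q] = x^-1; last exact: (subgroupV sH Hx).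
rewrite commgEl aqE (commute_sym (commuteV (commute_sym com_x))).
by rewrite mulKg.
Qed.

End DerivedGenerators.

(** * Identities for braided elements *)

(** The product $rq$ has order three, so that $rq = (qr)^2$. *)
Lemma braid_commg (G : groupType) (r q : G) :
    r * r = 1 -> q * q = 1 -> r * q * r = q * r * q -> r * q = [~ q, r].
Proof.
move=> rr qq rqr; rewrite commgEl conjgE (mulg1_eq rr) (mulg1_eq qq) !mulgA.
by rewrite -rqr -!mulgA rr mulg1.
Qed.

Lemma braid_conjg (G : groupType) (x y : G) :
  x * y * x = y * x * y -> x ^ (y * x) = y.
Proof. by move=> xyx; rewrite conjgE (mulgA x) xyx mulKg. Qed.

Lemma commg_mulr_central (G : groupType) (x y z : G) :
  commute x z -> commute y z -> [~ x * z, y * z] = [~ x, y].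
Proof.
move=> xz yz; have [xz_fix yz_fix] := (commute_conjg xz, commute_conjg yz).
have z_fix : z ^ (y * z) = z.
  by apply/commute_conjg/commuteM; [exact: commute_sym | exact: commute_refl].
rewrite commgEl conjMg z_fix conjgM conjJg xz_fix yz_fix invgM -mulgA.
rewrite (mulgA x^-1) -commgEl -(conjgE _ z) conjRg.
by rewrite xz_fix yz_fix.
Qed.

(** * Generators and relations of the welded braid group *)

Section WeldedBraid.

Variable m : nat.

Local Notation I := ('I_m.+2).

(** Natural number indices, counted from 0, avoid transporting bounds; an index out
    of range is sent by [inord] to the first generator. *)
Definition rho (i : nat) : WB m.+3 :=
  word_class (@wb_rel m.+3) (gen_word (inr (inord i : I) : wb_gen m.+3)).

Definition sigma (i : nat) : WB m.+3 :=
  word_class (@wb_rel m.+3) (gen_word (inl (inord i : I) : wb_gen m.+3)).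

Let classM u v : word_class (@wb_rel m.+3) (u ++ v) =
  (word_class (@wb_rel m.+3) u : WB m.+3) * word_class (@wb_rel m.+3) v.
Proof. by rewrite -presented_mulE. Qed.

Let rel_eq u v : wb_rel u v ->
  word_class (@wb_rel m.+3) u = word_class (@wb_rel m.+3) v.
Proof. by move=> uv; apply/word_classE/cong_rel. Qed.

Local Notation cl := (word_class (@wb_rel m.+3) : _ -> WB m.+3).

Let rel_eq2 u v u' v' : wb_rel (u ++ v) (u' ++ v') ->
  cl u * cl v = cl u' * cl v'.
Proof. by rewrite -!classM; exact: rel_eq. Qed.

Let rel_eq3 u v w u' v' w' : wb_rel (u ++ v ++ w) (u' ++ v' ++ w') ->
  cl u * cl v * cl w = cl u' * cl v' * cl w'.
Proof. by move=> /rel_eq; rewrite !classM !mulgA. Qed.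

Let inord_far i j : i.+1 < j < m.+2 ->
  far (inord i : 'I_(m.+3).-1) (inord j) /\
  far (inord j : 'I_(m.+3).-1) (inord i).
Proof.
case/andP=> ij jm; rewrite /far !inordK ?ij ?orbT //.
by apply: ltn_trans jm; exact: ltnW.
Qed.

Let inord_next i : i.+1 < m.+2 -> (inord i.+1 : I) = (inord i : I).+1 :> nat.
Proof. by move=> im; rewrite !inordK // ltnW. Qed.

Lemma rho_sqr i : rho i * rho i = 1.
Proof. by rewrite /rho -classM; apply: rel_eq; exact: wb_sym_sqr. Qed.

Lemma rhoV i : (rho i)^-1 = rho i.
Proof. exact/mulg1_eq/rho_sqr. Qed.

Lemma rhoK i g : g * rho i * rho i = g.
Proof. by rewrite -mulgA rho_sqr mulg1. Qed.

Lemma rho_far i j : i.+1 < j < m.+2 -> commute (rho i) (rho j).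
Proof.
move=> /inord_far[ij _]; apply: rel_eq2.
exact: wb_sym_far.
Qed.

Lemma rho_braid i : i.+1 < m.+2 ->
  rho i * rho i.+1 * rho i = rho i.+1 * rho i * rho i.+1.
Proof.
move=> /inord_next ij; apply: rel_eq3.
exact: wb_sym.
Qed.

Lemma sigma_braid i : i.+1 < m.+2 ->
  sigma i * sigma i.+1 * sigma i = sigma i.+1 * sigma i * sigma i.+1.
Proof.
move=> /inord_next ij; apply: rel_eq3.
exact: wb_braid.
Qed.

Lemma mixed_far i j : i.+1 < j < m.+2 -> commute (sigma i) (rho j).
Proof.
move=> /inord_far[ij _]; apply: rel_eq2.
exact: wb_mixed_far.
Qed.

Lemma mixed i : i.+1 < m.+2 ->
  rho i * rho i.+1 * sigma i = sigma i.+1 * rho i * rho i.+1.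
Proof.
move=> /inord_next ij; apply: rel_eq3.
exact: wb_mixed.
Qed.

Lemma forbidden i : i.+1 < m.+2 ->
  rho i * sigma i.+1 * sigma i = sigma i.+1 * sigma i * rho i.+1.
Proof.
move=> /inord_next ij; apply: rel_eq3.
exact: wb_forbidden.
Qed.

(** A generator of the pure welded braid group: it acts on the free group by
    conjugating one basis element by another. *)
Definition alpha := rho 0 * sigma 0.

Lemma alpha_far i : 1 < i < m.+2 -> commute alpha (rho i).
Proof.
move=> im; apply/commute_sym/commuteM; apply: commute_sym.
  exact: rho_far.
exact: mixed_far.
Qed.

(** The mixed relations conjugate $\sigma_i$ to $\sigma_{i+1}$ by elements
    $\rho_i\rho_{i+1}$, so one of the $\sigma$'s is enough. *)
Lemma WB_full (K : set (WB m.+3)) :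
  subgroup K -> (forall i, i < m.+2 -> K (rho i)) -> K alpha ->
  K = [set: WB m.+3].
Proof.
move=> sK Krho Ka.
have Ks i : i < m.+2 -> K (sigma i).
  elim: i => [|i IHi] im.
    by rewrite -(mulKg (rho 0) (sigma 0)) rhoV; exact: (subgroupM sK (Krho 0 _)).
  have -> : sigma i.+1 = rho i * rho i.+1 * sigma i / (rho i * rho i.+1).
    by rewrite mixed // -[X in X / _]mulgA mulgK.
  have Krr : K (rho i * rho i.+1).
    by apply: subgroupM => //; apply: Krho => //; exact: ltnW.
  exact: (subgroupM sK (subgroupM sK Krr (IHi (ltnW im))) (subgroupV sK Krr)).
rewrite -subTset => g _.
have [u ->] := presentedP g; elim: u => [|[b z] u IHu].
  exact: (subgroup1 sK).
rewrite -cat1s classM; apply: (subgroupM sK) IHu.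
have Kz : K (word_class _ (gen_word z)).
  by case: z => i; rewrite -[i]inord_val; [exact: Ks | exact: Krho].
case: b => //; have := subgroupV sK Kz.
by rewrite -[_^-1]/(presented_inv _) presented_invE.
Qed.

(** * The commutator subgroup of the welded braid group *)

Let D := WB' m.+3.

Let sD : subgroup D. Proof. exact: derived_subgroup. Qed.
Let nD : normal D. Proof. exact: derived_normal. Qed.

Lemma rho_next_derived i : i.+1 < m.+2 -> D (rho i.+1 * rho i).
Proof.
move=> im; rewrite (braid_commg _ _ (esym (rho_braid im))) ?rho_sqr //.
exact: derivedR.
Qed.

Lemma rho_mul_mem (K : set (WB m.+3)) : subgroup K ->
    (forall i, i.+1 < m.+2 -> K (rho i.+1 * rho i)) ->
  forall i j, i < m.+2 -> j < m.+2 -> K (rho i * rho j).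
Proof.
move=> sK Knext; have K0 i : i < m.+2 -> K (rho i * rho 0).
  elim: i => [|i IHi] im; first by rewrite rho_sqr; exact: (subgroup1 sK).
  have -> : rho i.+1 * rho 0 = (rho i.+1 * rho i) * (rho i * rho 0).
    by rewrite mulgA rhoK.
  exact: (subgroupM sK (Knext _ im) (IHi (ltnW im))).
move=> i j /K0 Ki /K0/(subgroupV sK) Kj.
by have := subgroupM sK Ki Kj; rewrite invgM !rhoV mulgA rhoK.
Qed.

Definition WB'_gens : seq (WB m.+3) :=
  derived_gens (rho 0) (rho 1) alpha [seq rho i | i <- iota 2 m].

Lemma size_WB'_gens : size WB'_gens = m.+4.
Proof. by rewrite size_cat !size_map size_iota. Qed.

Lemma generated_WB'_gens : generated [set` WB'_gens] = WB' m.+3.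
Proof.
have mem_rho (P : WB m.+3 -> Prop) :
    (forall i, 1 < i < m.+2 -> P (rho i)) ->
  forall p, p \in [seq rho i | i <- iota 2 m] -> P p.
  by move=> Prho p /mapP[i]; rewrite mem_iota addSn add1n => ? ->; exact: Prho.
have com_b := forbidden_commute (rho_sqr 0) (rho_sqr 1) (@rho_braid 0 isT)
  (@mixed 0 isT) (@forbidden 0 isT) (erefl alpha) erefl.
have com_c := braid_commute (rho_sqr 0) (rho_sqr 1) (@rho_braid 0 isT)
  (@sigma_braid 0 isT) (@mixed 0 isT) (@forbidden 0 isT) (erefl alpha) erefl.
apply: generated_derived_gens => //; try exact: rho_sqr.
- by apply: mem_rho => i _; exact: rho_sqr.
- by apply: mem_rho => i; exact: alpha_far.
- set A := (_ `|` _); have sub_A x : A x -> generated A x.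
    exact: sub_generated.
  apply: WB_full; first exact: generated_subgroup.
    move=> [|[|i]] im; apply: sub_A.
    + by right; left; left.
    + by right; left; right.
    + by left; apply: map_f; rewrite mem_iota addSn add1n.
  by apply: sub_A; right; right.
- rewrite (braid_commg _ _ (rho_braid _)) ?rho_sqr //; exact: derivedR.
- by apply: mem_rho => i /andP[i1 im]; exact: (rho_mul_mem sD rho_next_derived).
Qed.

Lemma WB'_generated_by_card :
  exists2 k, generated_by_card (WB' m.+3) k & k <= m.+4.
Proof.
exists #|` [fset x in WB'_gens]|%fset.
  exists [fset x in WB'_gens]%fset => //; rewrite -generated_WB'_gens.
  by congr generated; apply/seteqP; split=> x /=; rewrite !inE.
by rewrite -size_WB'_gens card_fseq; exact: size_undup.
Qed.

(** With at least five strands $\rho_4$ commutes with $\rho_1$, $\rho_2$ and $a$.  This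
    makes $\rho_2\rho_1$ a commutator of even elements and makes the quotient by the
    second derived subgroup abelian. *)
Lemma WB'_perfect : 1 < m -> perfect (WB' m.+3).
Proof.
move=> m1; rewrite /perfect -/D.
have sD2 : subgroup (derived D) by exact: derived_subgroup.
have nD2 : normal (derived D) by exact: derived_normal.
have im3 : 3 < m.+2 by [].
apply/seteqP; split.
  by apply: generated_sub => // _ [x _ [y _ <-]]; exact: derivedR.
have D_rho i j : i < m.+2 -> j < m.+2 -> D (rho i * rho j).
  exact: (rho_mul_mem sD rho_next_derived).
have D2_10 : derived D (rho 1 * rho 0).
  have -> : rho 1 * rho 0 = [~ rho 0 * rho 3, rho 1 * rho 3].
    rewrite commg_mulr_central; try exact: rho_far.
    by rewrite (braid_commg _ _ (esym (rho_braid _))) ?rho_sqr.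
  by apply: derivedR; exact: D_rho.
have D2_next i : i.+1 < m.+2 -> derived D (rho i.+1 * rho i).
  elim: i => [//|i IHi] im.
  (* This product of three transpositions shifts the indices i and i + 1. *)
  have -> : rho i.+2 * rho i.+1 =
      (rho i.+1 * rho i) ^ (rho i.+2 * rho i.+1 * rho i).
    have far : commute (rho i) (rho i.+2) by apply: rho_far; rewrite leqnn.
    have rho_i : rho i ^ (rho i.+2 * rho i.+1 * rho i) = rho i.+1.
      rewrite -(mulgA (rho i.+2)) conjgM (commute_conjg far).
      exact: braid_conjg (rho_braid (ltnW im)).
    have rho_i1 : rho i.+1 ^ (rho i.+2 * rho i.+1 * rho i) = rho i.+2.
      rewrite conjgM (braid_conjg (rho_braid im)).
      exact/commute_conjg/commute_sym.
    by rewrite conjMg rho_i rho_i1.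
  by apply: nD2; apply: IHi; exact: ltnW.
apply: (@derived_sub_two _ (derived D) alpha (rho 3)) => //; last first.
  have -> : [~ alpha, rho 3] = 1 by exact/eqP/commgP/alpha_far.
  exact: (subgroup1 sD2).
have sK := generated_subgroup (derived D `|` [set alpha; rho 3]).
apply: (WB_full sK) => [i im|]; last by apply: sub_generated; right; left.
rewrite -[rho i](rhoK 3); apply: (subgroupM sK).
  by apply: sub_generated; left; exact: (rho_mul_mem sD2 D2_next).
by apply: sub_generated; right; right.
Qed.

End WeldedBraid.

(** * Rank and perfectness *)

Theorem theorem1p1 :
  [/\ forall n : nat, 3 <= n -> finitely_generated (WB' n),
      forall n : nat, 7 <= n -> group_rank (WB' n) <= 1 + 2 * (n - 3),
      forall n : nat, 3 <= n <= 6 -> group_rank (WB' n) <= 4 + 2 * (n - 3)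
    & forall n : nat, 5 <= n -> perfect (WB' n)].
Proof.
have rank_le m : group_rank (WB' m.+3) <= m.+4.
  have [k gen_k le_k] := WB'_generated_by_card m.
  rewrite /group_rank; case: pselect => [exk | []]; last first.
    by exists k; exact/asboolP.
  case: ex_minnP => j _ /(_ k) le_j.
  by apply: leq_trans le_k; exact/le_j/asboolP.
split=> [[|[|[|m]]] // _|[|[|[|m]]] // m7|[|[|[|m]]] // _|[|[|[|m]]] // m5].
- have [k [A genA _] _] := WB'_generated_by_card m.
  by exists A.
- apply: leq_trans (rank_le m) _; rewrite !subSS subn0 mul2n -addnn.
  by rewrite -addn4 addnC addnA leq_add2r add1n; exact: ltnW.
- apply: leq_trans (rank_le m) _; rewrite !subSS subn0 mul2n -addnn.
  by rewrite -addn4 addnC leq_add2l leq_addr.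
- exact: WB'_perfect.
Qed.
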